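(* Let $G$ be an irreducible and essential reflection group acting on $V\cong\mathbb{R}^n$. Then the following are equivalent: (a) for every $1\le k\le n$, every nonempty $k$-sparse $G$-invariant real variety $X\subseteq V$ satisfies $X\cap\mathcal{H}_k(G)\neq\emptyset$; (b) for every $1\le k\le n$ and every choice of basic invariants $\pi_1,\dots,\pi_n$ ordered by nondecreasing degree, $\pi_J(V) = \pi_J(\mathcal{H}_k(G))$ for $J = \{1,\dots,k\}$.
   Context: A (real) reflection group $G$ acting on a Euclidean space $V \cong \mathbb{R}^n$ is a finite group of orthogonal transformations generated by reflections. It is irreducible if it is not the product of two nontrivial reflection groups, and essential if it fixes no nontrivial linear subspace pointwise. Its reflection arrangement is the set of reflection hyperplanes of all reflections in $G$; flats are intersections of reflection hyperplanes (including $V$ itself), and $\mathcal{H}_i(G)$ is the set of points of $V$ contained in a flat of dimension $i$. A set of basic invariants $\pi_1,\dots,\pi_n$ is a set of $n$ algebraically independent homogeneous generators of $\mathbb{R}[V]^G$, labelled so that $\deg \pi_1\le\dots\le\deg\pi_n$. A $G$-invariant real variety $X\subseteq V$ (a set of common real zeros of polynomials) is $k$-sparse if it is the set of common real zeros of some $f_1,\dots,f_m\in\mathbb{R}[\pi_1,\dots,\pi_k]$, for some choice of basic invariants ordered by nondecreasing degree. For $J\subseteq\{1,\dots,n\}$, $\pi_J : V \to \mathbb{R}^{J}$ is the map $\pi_J(x) = (\pi_i(x) : i \in J)$. *)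

(* Defs.v *)
From HB Require Import structures.
From mathcomp Require Import all_boot all_order all_algebra.
From mathcomp Require Import boolp classical_sets functions cardinality reals.
From mathcomp Require Import mpoly.

Set Implicit Arguments.
Unset Strict Implicit.
Unset Printing Implicit Defensive.

Import Order.TTheory GRing.Theory Num.Theory.

Local Open Scope classical_set_scope.
Local Open Scope ring_scope.

(* The Euclidean space V is 'cV[R]_n with inner product v^T *m w; a linear
   transformation A acts by x |-> A *m x. *)

Section ReflectionGroups.
Variable R : realType.

Definition linear_group n (G : set 'M[R]_n) : Prop :=
  [/\ forall A, G A -> A \in unitmx,
      G 1%:M,
      forall A B, G A -> G B -> G (A *m B) &
      forall A, G A -> G (invmx A)].

Definition orthogonal_mx n (A : 'M[R]_n) : Prop := A^T *m A = 1%:M.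

(* x |-> x - 2 <v, x> / <v, v> v for some v != 0 *)
Definition is_reflection n (A : 'M[R]_n) : Prop :=
  exists2 v : 'cV[R]_n, v != 0 &
    A = 1%:M - (2 / (v^T *m v) 0 0) *: (v *m v^T).

Definition reflections n (G : set 'M[R]_n) : set 'M[R]_n :=
  [set A | G A /\ is_reflection A].

(* The last clause says that G is generated by its reflections: it lies in
   every group containing them. *)
Definition reflection_group n (G : set 'M[R]_n) : Prop :=
  [/\ linear_group G,
      finite_set G,
      forall A, G A -> orthogonal_mx A &
      forall H : set 'M[R]_n,
        linear_group H -> reflections G `<=` H -> G `<=` H].

Definition nontrivial_group n (G : set 'M[R]_n) : Prop :=
  exists2 A, G A & A <> 1%:M.

(* The product of reflection groups G1 on R^n1 and G2 on R^n2 acts diagonally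
   on R^(n1 + n2); P is a linear isometry from R^n onto R^(n1 + n2). *)
Definition is_product n (G : set 'M[R]_n) n1 n2
    (G1 : set 'M[R]_n1) (G2 : set 'M[R]_n2) : Prop :=
  exists P : 'M[R]_(n1 + n2, n),
    [/\ P^T *m P = 1%:M,
        P *m P^T = 1%:M &
        forall A, G A <->
          exists A1 A2, [/\ G1 A1, G2 A2 &
            A = P^T *m block_mx A1 0 0 A2 *m P]].

Definition irreducible_group n (G : set 'M[R]_n) : Prop :=
  ~ exists n1 n2 (G1 : set 'M[R]_n1) (G2 : set 'M[R]_n2),
      [/\ reflection_group G1, nontrivial_group G1,
          reflection_group G2, nontrivial_group G2 &
          is_product G G1 G2].

Definition essential_group n (G : set 'M[R]_n) : Prop :=
  forall U : {vspace 'cV[R]_n},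
    (forall A x, G A -> x \in U -> A *m x = x) -> U = 0%VS.

Definition reflection_hyperplane n (A : 'M[R]_n) : {vspace 'cV[R]_n} :=
  fixedSpace (linfun (mulmx A : 'cV[R]_n -> 'cV[R]_n)).

(* The empty intersection is V itself. *)
Definition is_flat n (G : set 'M[R]_n) (L : {vspace 'cV[R]_n}) : Prop :=
  exists2 s : seq 'M[R]_n, (forall A, A \in s -> reflections G A) &
    L = (\bigcap_(A <- s) reflection_hyperplane A)%VS.

Definition strata n (G : set 'M[R]_n) (i : nat) : set 'cV[R]_n :=
  [set x | exists L, [/\ is_flat G L, \dim L = i & x \in L]].

End ReflectionGroups.

Section Invariants.
Variable R : realType.

Definition evalV n (f : {mpoly R[n]}) (x : 'cV[R]_n) : R :=
  f.@[fun i => x i 0].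

Definition invariant_poly n (G : set 'M[R]_n) (f : {mpoly R[n]}) : Prop :=
  forall A x, G A -> evalV f (A *m x) = evalV f x.

Definition alg_independent n m (p : m.-tuple {mpoly R[n]}) : Prop :=
  forall q : {mpoly R[m]}, q \mPo p = 0 -> q = 0.

(* f lies in R[p_1, ..., p_m] *)
Definition in_subalgebra n m (p : m.-tuple {mpoly R[n]}) (f : {mpoly R[n]}) :
    Prop :=
  exists q : {mpoly R[m]}, f = q \mPo p.

(* msize is the degree plus one for nonzero polynomials, and algebraic
   independence excludes 0, so the last clause orders by degree. *)
Definition basic_invariants n (G : set 'M[R]_n)
    (p : n.-tuple {mpoly R[n]}) : Prop :=
  [/\ forall i : 'I_n, exists d : nat, tnth p i \is d.-homog,
      alg_independent p,
      forall f, invariant_poly G f <-> in_subalgebra p f &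
      forall i j : 'I_n, (i <= j)%N ->
        (msize (tnth p i) <= msize (tnth p j))%N].

Definition first_invariants n k (le_kn : (k <= n)%N)
    (p : n.-tuple {mpoly R[n]}) : k.-tuple {mpoly R[n]} :=
  [tuple tnth p (widen_ord le_kn i) | i < k].

Definition zero_locus n (fs : seq {mpoly R[n]}) : set 'cV[R]_n :=
  [set x | forall f, f \in fs -> evalV f x = 0].

Definition real_variety n (X : set 'cV[R]_n) : Prop :=
  exists fs, X = zero_locus fs.

Definition invariant_set n (G : set 'M[R]_n) (X : set 'cV[R]_n) : Prop :=
  forall A x, G A -> X x -> X (A *m x).

Definition sparse n (G : set 'M[R]_n) k (le_kn : (k <= n)%N)
    (X : set 'cV[R]_n) : Prop :=
  exists2 p, basic_invariants G p &
    exists2 fs,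
      (forall f, f \in fs -> in_subalgebra (first_invariants le_kn p) f) &
      X = zero_locus fs.

Definition invariant_map n (p : n.-tuple {mpoly R[n]}) (J : {set 'I_n})
    (x : 'cV[R]_n) : {ffun {i : 'I_n | i \in J} -> R} :=
  [ffun i => evalV (tnth p (val i)) x].

End Invariants.

(* Main.v *)
Require Import Defs.
From HB Require Import structures.
From mathcomp Require Import all_boot all_order all_algebra.
From mathcomp Require Import boolp classical_sets functions cardinality reals.
From mathcomp Require Import mpoly.

Set Implicit Arguments.
Unset Strict Implicit.
Unset Printing Implicit Defensive.

Import Order.TTheory GRing.Theory Num.Theory.

Local Open Scope classical_set_scope.
Local Open Scope ring_scope.

(** Both conditions say that every fibre of the map given by the first [k] basic invariants meets
    [strata G k]. Such a fibre is the common zero set of the polynomials [tnth p i - c_i] with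
    [i < k], hence a nonempty [k]-sparse variety. Conversely, a polynomial in the first [k]
    invariants is constant on each fibre, so a [k]-sparse variety is a union of fibres, and a
    stratum point in the fibre of one of its points lies in it. *)

Lemma evalV_comp (R : realType) n m (p : m.-tuple {mpoly R[n]})
    (q : {mpoly R[m]}) (x : 'cV[R]_n) :
  evalV (q \mPo p) x = q.@[fun i => evalV (tnth p i) x].
Proof. exact: comp_mpoly_meval. Qed.

(** Substituting [p] into the variable ['X_i] gives [tnth p i], which therefore lies in the
    subalgebra that is the invariant ring. *)
Lemma basic_invariants_invariant (R : realType) n (G : set 'M[R]_n)
    (p : n.-tuple {mpoly R[n]}) (i : 'I_n) :
  basic_invariants G p -> invariant_poly G (tnth p i).
Proof. by case=> _ _ inv _; apply/inv; exists 'X_i; rewrite comp_mpolyXU -tnth_nth. Qed.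

Lemma invariant_map_eq (R : realType) n (p : n.-tuple {mpoly R[n]})
    (J : {set 'I_n}) (x y : 'cV[R]_n) :
  invariant_map p J x = invariant_map p J y <->
  forall i, i \in J -> evalV (tnth p i) x = evalV (tnth p i) y.
Proof.
split=> [exy i iJ|exy].
  by have /ffunP/(_ (exist _ i iJ)) := exy; rewrite !ffunE.
by apply/ffunP=> -[i iJ]; rewrite !ffunE exy.
Qed.

Theorem proposition8 (R : realType) (n : nat) (G : set 'M[R]_n)
    (G_refl : reflection_group G)
    (G_irr : irreducible_group G)
    (G_ess : essential_group G) :
  (forall (k : nat) (le_kn : (k <= n)%N), (1 <= k)%N ->
     forall X : set 'cV[R]_n,
       real_variety X -> invariant_set G X -> sparse G le_kn X ->
       X !=set0 -> X `&` strata G k !=set0)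
  <->
  (forall (k : nat), (1 <= k <= n)%N ->
     forall p : n.-tuple {mpoly R[n]}, basic_invariants G p ->
       let J := [set i : 'I_n | (i < k)%N]%SET in
       invariant_map p J @` setT = invariant_map p J @` strata G k).
Proof.
split=> [sparse_strata k /andP[k_gt0 le_kn] p p_basic J|map_strata k le_kn k_gt0 X].
  apply/seteqP; split=> [_ [x _ <-]|_ [x _ <-]]; last by exists x.
  (* The fibre of [invariant_map p J] through [x] is itself k-sparse. *)
  pose fs := [seq tnth p i - (evalV (tnth p i) x)%:MP | i <- enum J].
  have fsP y : zero_locus fs y <->
      forall i, i \in J -> evalV (tnth p i) y = evalV (tnth p i) x.
    split=> [y0 i iJ|exy _ /mapP[i iJ ->]].
      apply/eqP; rewrite -subr_eq0; apply/eqP.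
      have := y0 (tnth p i - (evalV (tnth p i) x)%:MP).
      rewrite [evalV (_ - _) _]mevalB mevalC; apply.
      by apply: (map_f (fun i => _)); rewrite mem_enum.
    rewrite [LHS]mevalB mevalC -/(evalV _ _) exy ?subrr //.
    by rewrite -mem_enum.
  have [||||y [/fsP exy yk]] := sparse_strata k le_kn k_gt0 (zero_locus fs).
  - by exists fs.
  - move=> A y GA /fsP exy; apply/fsP=> i iJ.
    by rewrite (basic_invariants_invariant i p_basic) ?exy.
  - exists p => //; exists fs => // _ /mapP[i iJ ->].
    have ltik : (i < k)%N by move: iJ; rewrite mem_enum inE.
    (* The equation of the fibre is linear in the [k] invariants; [i] has to be reindexed from
       ['I_n] to ['I_k]. *)
    exists ('X_(Ordinal ltik) - (evalV (tnth p i) x)%:MP).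
    rewrite comp_mpolyB comp_mpolyC comp_mpolyXU -tnth_nth tnth_mktuple.
    by congr (tnth p _ - _); apply: val_inj.
  - by exists x; apply/fsP.
  - by exists y => //; apply/invariant_map_eq.
move=> _ _ [p p_basic [fs fs_sub ->]] [x x0].
have := map_strata k; rewrite k_gt0 le_kn => /(_ isT p p_basic) /= map_eq.
(* The image equality, applied to the value at the given zero [x], yields a stratum point [y] in the
   fibre of [x]. *)
have : (invariant_map p [set i : 'I_n | (i < k)%N]%SET @` setT)
    (invariant_map p [set i : 'I_n | (i < k)%N]%SET x) by exists x.
rewrite map_eq => -[y yk /invariant_map_eq exy].
exists y; split=> // f f_fs.
have [q ef] := fs_sub f f_fs.
(* [f] sees a point only through its first [k] invariants, which agree at [x] and [y]; so [f]
   vanishes at [y] as it does at [x]. *)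
rewrite -(x0 f f_fs) ef !evalV_comp; apply: meval_eq => i.
by rewrite tnth_mktuple exy // inE /=.
Qed.
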